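(* Let $n\ge1$. The operators $\pi_i:\mathrm{MT}_n\to\mathrm{MT}_n$, $T\mapsto T\times\pi_i$ ($i=1,\ldots,n-1$), acting on the right, satisfy the braid relations $$\pi_i\pi_j=\pi_j\pi_i\ \text{ for }|i-j|\ge2,\qquad \pi_i\pi_{i+1}\pi_i=\pi_{i+1}\pi_i\pi_{i+1}\ \text{ for }i=1,\ldots,n-2,$$ and the quadratic relations $\pi_i^2=\pi_i$ for $i=1,\ldots,n-1$, and hence define a (right) action of the $0$-Hecke monoid $\mathcal{H}_n(0)$ on $\mathrm{MT}_n$.
   Context: $[n]=\{1,\ldots,n\}$. A set $J=\{j_1<\cdots<j_{m+1}\}$ interlaces $I=\{i_1<\cdots<i_m\}$ if $j_1\le i_1\le j_2\le\cdots\le j_m\le i_m\le j_{m+1}$. A monotone triangle of size $n$ is a sequence $T=(T_0,T_1,\ldots,T_n)$ of subsets of $[n]$ with $\#T_m=m$ and $T_{m+1}$ interlacing $T_m$ for $0\le m<n$; $\mathrm{MT}_n$ is the set of all of these. For $T\in\mathrm{MT}_n$ and $1\le i\le n-1$, write $T_{i-1}=\{a_1<\cdots<a_{i-1}\}$, $T_{i+1}=\{b_1<\cdots<b_{i+1}\}$, and let $H_{\min}(T_{i-1},T_{i+1})=\{h_1<\cdots<h_i\}$ with $h_m=\max(a_{m-1},b_m)$, where $a_0:=0$. Then $T\times\pi_i$ is the monotone triangle obtained from $T$ by replacing its row $T_i$ with $H_{\min}(T_{i-1},T_{i+1})$. Products act on the right: $T\times(\pi_i\pi_j)=(T\times\pi_i)\times\pi_j$.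 The $0$-Hecke monoid $\mathcal{H}_n(0)$ is the monoid generated by $\pi_1,\ldots,\pi_{n-1}$ subject to the braid and quadratic relations displayed in the claim. *)

(* Defs.v *)
From HB Require Import structures.
From mathcomp Require Import all_boot all_order all_fingroup ssrint.
From mathcomp Require Import generic_quotient.
From mathcomp Require Import boolp.
From mathcomp Require Import zify.

Set Implicit Arguments.
Unset Strict Implicit.
Unset Printing Implicit Defensive.

(* A subset of [n] = {1, ..., n} is a set A : {set 'I_n}, the ordinal x
   (with 0 <= x < n) standing for the integer x + 1. *)

(* The elements of A in increasing order ([enum] lists ordinals in increasing
   order). *)
Definition elts n (A : {set 'I_n}) : seq nat := [seq (val x).+1 | x <- enum A].

(* [elt A m] is a_m for A = {a_1 < a_2 < ...}, with the convention a_0 = 0. *)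
Definition elt n (A : {set 'I_n}) (m : nat) : nat := nth 0 (0 :: elts A) m.

(* The ordinal m : 'I_#|I| stands for the index m + 1 of i_1 < ... < i_#|I|. *)
Definition interlaces n (J I : {set 'I_n}) : bool :=
  (#|J| == #|I|.+1) &&
  [forall m : 'I_#|I|, elt J m.+1 <= elt I m.+1 <= elt J m.+2].

Definition row n (T : n.+1.-tuple {set 'I_n}) (m : nat) : {set 'I_n} :=
  nth set0 T m.

Definition is_monotone_triangle n (T : n.+1.-tuple {set 'I_n}) : bool :=
  [forall m : 'I_n.+1, #|row T m| == m] &&
  [forall m : 'I_n, interlaces (row T m.+1) (row T m)].

Record MT (n : nat) := MonotoneTriangle {
  rows :> n.+1.-tuple {set 'I_n};
  _ : is_monotone_triangle rows }.

HB.instance Definition _ n := [isSub for @rows n].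
HB.instance Definition _ n := [Finite of MT n by <:].

(* The set {h_1 < ... < h_i} with i = #|A| + 1 and
   h_(m + 1) = max(a_m, b_(m + 1)) for 0 <= m < i. *)
Definition Hmin n (A B : {set 'I_n}) : {set 'I_n} :=
  [set x : 'I_n |
    [exists m : 'I_#|A|.+1, x.+1 == maxn (elt A m) (elt B m.+1)]].

(* The ordinal k : 'I_n.-1 stands for the index i = k + 1 in {1, ..., n - 1},
   so that T_(i-1), T_i, T_(i+1) are the rows k, k + 1, k + 2 of T. *)
Definition mt_pi_rows n (T : MT n) (k : 'I_n.-1) : n.+1.-tuple {set 'I_n} :=
  [tuple if m == k.+1 :> nat then Hmin (row T k) (row T k.+2) else row T m
     | m < n.+1].

Section MtPi.
Variable n : nat.
Implicit Types (A B C : {set 'I_n}) (T : MT n).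

Lemma size_elts A : size (elts A) = #|A|.
Proof. by rewrite size_map -cardE. Qed.

Lemma elts_sorted A : sorted ltn (elts A).
Proof.
have : subseq (elts A) [seq (val x).+1 | x <- enum 'I_n].
  by rewrite map_subseq // {1}/enum_mem enumT filter_subseq.
move=> /(subseq_sorted ltn_trans); apply.
rewrite (map_comp succn val) val_enum_ord.
by rewrite (homo_sorted (e := ltn)) ?iota_ltn_sorted.
Qed.

Lemma mem_elts A (x : 'I_n) : (x.+1 \in elts A) = (x \in A).
Proof.
rewrite -(mem_enum A) /elts; apply: (mem_map (f := fun x : 'I_n => (val x).+1)).
by move=> u v [] /val_inj.
Qed.

Lemma elts_range A y : y \in elts A -> 0 < y <= n.
Proof. by case/mapP=> x _ ->; apply: (ltn_ord x). Qed.

Lemma elt_range A m : m < #|A| -> 0 < elt A m.+1 <= n.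
Proof. by move=> h; apply: (@elts_range A); apply: mem_nth; rewrite size_elts. Qed.

Lemma elt_lt A m : m < #|A| -> elt A m < elt A m.+1.
Proof.
case: m => [|m] h; first by case/andP: (elt_range h).
have := elts_sorted A => /(sortedP 0) /(_ m); apply; by rewrite size_elts.
Qed.

(* An increasing sequence with values in [n] is the list of elements of a
   set. *)
Lemma elts_eq A (s : seq nat) : sorted ltn s ->
  (forall y, y \in s -> 0 < y <= n) ->
  (forall x : 'I_n, (x \in A) = (x.+1 \in s)) -> elts A = s.
Proof.
move=> ss sr sA; apply: (irr_sorted_eq ltn_trans ltnn) => //.
  exact: elts_sorted.
move=> y; apply/idP/idP => ys.
  by case/mapP: ys => x; rewrite mem_enum sA => h ->.
have /andP[y0 yn] := sr _ ys; case: y y0 yn ys => // y _ yn ys.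
by rewrite (mem_elts A (Ordinal yn)) sA.
Qed.

Lemma elts_Hmin A B C : interlaces C A -> interlaces B C ->
  elts (Hmin A B) =
  mkseq (fun m => maxn (elt A m) (elt B m.+1)) #|A|.+1.
Proof.
move=> /andP[/eqP cCA /forallP hCA] /andP[/eqP cBC /forallP hBC].
apply: elts_eq.
- apply/(sortedP 0) => i; rewrite size_mkseq => hi.
  rewrite !nth_mkseq //; last by lia.
  have := @elt_lt A i; have := @elt_lt B i.+1; lia.
- move=> y /mapP[m]; rewrite mem_iota => /andP[_ hm] ->.
  have hB : m < #|B| by lia.
  have := elt_range hB; case: m hm hB => [|m] hm hB; first by rewrite /elt /=; lia.
  have hA : m < #|A| by lia.
  by have := elt_range hA; lia.
- move=> x; rewrite inE; apply/existsP/mapP => [[m /eqP ->]|[m]].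
    by exists (val m); rewrite // mem_iota /=; case: m.
  by rewrite mem_iota => /andP[_ hm] ->; exists (Ordinal hm).
Qed.

Lemma Hmin_interlaces A B C : interlaces C A -> interlaces B C ->
  interlaces (Hmin A B) A /\ interlaces B (Hmin A B).
Proof.
move=> iCA iBC; have eH := elts_Hmin iCA iBC.
have cH : #|Hmin A B| = #|A|.+1 by rewrite -size_elts eH size_mkseq.
have eltH m : m < #|A|.+1 ->
    elt (Hmin A B) m.+1 = maxn (elt A m) (elt B m.+1).
  by move=> h; rewrite {1}/elt /= eH nth_mkseq.
move: iCA iBC => /andP[/eqP cCA /forallP hCA] /andP[/eqP cBC /forallP hBC].
have hCA' m : m < #|A| -> elt C m.+1 <= elt A m.+1 <= elt C m.+2.
  by move=> h; apply: (hCA (Ordinal h)).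
have hBC' m : m < #|C| -> elt B m.+1 <= elt C m.+1 <= elt B m.+2.
  by move=> h; apply: (hBC (Ordinal h)).
split; apply/andP; split; try (by apply/eqP; lia); apply/forallP => -[m /= hm].
  have := @elt_lt A m hm; have := hCA' m hm; have hC : m < #|C| by rewrite cCA leqW.
  by have := hBC' m hC; rewrite (eltH m (leqW hm)) (eltH m.+1 hm); lia.
rewrite cH in hm; have hC : m < #|C| by rewrite cCA.
have hB : m.+1 < #|B| by rewrite cBC ltnS.
have := elt_lt hB; have := hBC' m hC; rewrite !eltH //.
case: m hm hC hB => [|m] hm hC hB.
  by have : elt A 0 = 0; [by []|lia].
have hA : m < #|A| := hm; have := hCA' m hA; lia.
Qed.

Lemma row_mt_pi T (k : 'I_n.-1) m : m < n.+1 ->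
  row (mt_pi_rows T k) m =
  if m == k.+1 then Hmin (row T k) (row T k.+2) else row T m.
Proof.
move=> hm; rewrite {1}/row -[m]/(val (Ordinal hm)) -tnth_nth.
by rewrite tnth_mktuple.
Qed.

Lemma mt_pi_subproof T (k : 'I_n.-1) :
  is_monotone_triangle (mt_pi_rows T k).
Proof.
case: T => t tP; have /andP[/forallP tc /forallP ti] := tP.
set T := MonotoneTriangle tP.
have c m : m < n.+1 -> #|row T m| = m.
  by move=> h; apply/eqP/(tc (Ordinal h)).
have i m : m < n -> interlaces (row T m.+1) (row T m).
  by move=> h; apply: (ti (Ordinal h)).
have kn : k.+1 < n by case: (k) => /=; lia.
have kn' : k < n by lia.
have [i1 i2] := Hmin_interlaces (i k kn') (i k.+1 kn).
apply/andP; split; apply/forallP => -[m /= hm].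
  rewrite row_mt_pi //; case: (eqVneq m k.+1) => [->|_]; last by rewrite c.
  by case/andP: i1 => /eqP -> _; rewrite c ?eqxx; lia.
rewrite !row_mt_pi //; last by lia.
case: (eqVneq m.+1 k.+1) => [[->]|h1].
  by rewrite ifN //; apply/eqP; lia.
by case: (eqVneq m k.+1) => [->|_] //; apply: i.
Qed.

Definition mt_pi T (k : 'I_n.-1) : MT n :=
  MonotoneTriangle (mt_pi_subproof T k).

End MtPi.

(* The 0-Hecke monoid is the quotient of the free monoid on the generators,
   that is, of the words [seq 'I_n.-1], by the congruence generated by the
   defining relations.  The letter k stands for pi_(k + 1). *)
Inductive hecke_congr n : seq 'I_n.-1 -> seq 'I_n.-1 -> Prop :=
| hecke_comm (i j : 'I_n.-1) : 2 <= `|i - j| ->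
    hecke_congr [:: i; j] [:: j; i]
| hecke_braid (i j : 'I_n.-1) : j = i.+1 :> nat ->
    hecke_congr [:: i; j; i] [:: j; i; j]
| hecke_quad (i : 'I_n.-1) : hecke_congr [:: i; i] [:: i]
| hecke_refl u : hecke_congr u u
| hecke_sym u v : hecke_congr u v -> hecke_congr v u
| hecke_trans u v w : hecke_congr u v -> hecke_congr v w -> hecke_congr u w
| hecke_cat u u' v v' : hecke_congr u u' -> hecke_congr v v' ->
    hecke_congr (u ++ v) (u' ++ v').

Section Hecke.
Variable n : nat.

Definition hecke_rel (u v : seq 'I_n.-1) : bool := `[< hecke_congr u v >].

Lemma hecke_rel_refl : reflexive hecke_rel.
Proof. by move=> u; apply/asboolP; apply: hecke_refl. Qed.

Lemma hecke_rel_sym : symmetric hecke_rel.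
Proof.
by move=> u v; apply/asboolP/asboolP => h; apply: hecke_sym.
Qed.

Lemma hecke_rel_trans : transitive hecke_rel.
Proof.
move=> v u w /asboolP huv /asboolP hvw.
by apply/asboolP; apply: hecke_trans hvw.
Qed.

Canonical hecke_equiv :=
  EquivRel hecke_rel hecke_rel_refl hecke_rel_sym hecke_rel_trans.

Definition hecke := {eq_quot hecke_equiv}%qT.

HB.instance Definition _ := Choice.on hecke.
HB.instance Definition _ := EqQuotient.on hecke.

Definition hecke_word (u : seq 'I_n.-1) : hecke := (\pi_hecke u)%qT.

Lemma hecke_wordP u v :
  reflect (hecke_congr u v) (hecke_word u == hecke_word v).
Proof. by rewrite eqmodE; apply: asboolP. Qed.

Definition hecke_one : hecke := hecke_word [::].
Definition hecke_mul (x y : hecke) : hecke := hecke_word (repr x ++ repr y).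

Lemma hecke_wordK (x : hecke) : hecke_word (repr x) = x.
Proof. exact: reprK. Qed.

Lemma hecke_mul_word u v :
  hecke_mul (hecke_word u) (hecke_word v) = hecke_word (u ++ v).
Proof.
apply/eqP/hecke_wordP/hecke_cat; apply/hecke_wordP; by rewrite hecke_wordK.
Qed.

Lemma hecke_mulA : associative hecke_mul.
Proof.
move=> x y z; rewrite -(hecke_wordK x) -(hecke_wordK y) -(hecke_wordK z).
by rewrite !hecke_mul_word catA.
Qed.

Lemma hecke_mul1 : left_id hecke_one hecke_mul.
Proof. by move=> x; rewrite -(hecke_wordK x) hecke_mul_word. Qed.

Lemma hecke_mulr1 : right_id hecke_one hecke_mul.
Proof. by move=> x; rewrite -(hecke_wordK x) hecke_mul_word cats0. Qed.

HB.instance Definition _ :=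
  isMonoid.Build hecke hecke_mulA hecke_mul1 hecke_mulr1.

Definition hecke_gen (k : 'I_n.-1) : hecke := hecke_word [:: k].

End Hecke.

Definition is_right_action (M : monoidType) (X : Type) (act : X -> M -> X) :=
  (forall x, act x 1%g = x) /\
  (forall x a b, act x (a * b)%g = act (act x a) b).

(* Main.v *)
Require Import Defs.
From mathcomp Require Import all_boot all_fingroup ssrint.
From mathcomp Require Import generic_quotient boolp zify.

(** A monotone triangle is a triangular array of integers
    [t m p = elt (row T m) p], [1 <= p <= m], and [pi_i] rewrites row [i] as a
    function of the two neighbouring rows alone. Two relations follow from this
    locality: [pi_i] changes nothing that [pi_i] reads, so it is idempotent,
    and for [|i - j| >= 2] neither of [pi_i], [pi_j] changes what the other
    one reads or writes, so they commute.

    For the braid relation, let [a], [x], [y], [b] be the rows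
    [i - 1], ..., [i + 2]; only [x] and [y] change. Interlacing gives
    [y_(p-1) <= b_p] and [x_p <= a_p], and these inequalities make the old [x]
    and [y] disappear from the results. For [pi_i pi_(i+1) pi_i], row [i + 1]
    becomes
      [max (max a_(p-2) y_(p-1)) b_p = max a_(p-2) b_p]
    and then row [i] becomes [max a_(p-1) b_p]. For [pi_(i+1) pi_i pi_(i+1)],
    row [i] becomes
      [max a_(p-1) (max x_(p-1) b_p) = max a_(p-1) b_p]
    and then row [i + 1] becomes [max a_(p-2) b_p]. Both words thus yield the
    same rows, which depend on [a] and [b] only ([braid_iji], [braid_jij]).

    The relations make the action of words on triangles constant on congruence
    classes ([hecke_congr_foldl]), so it descends to the quotient monoid; it is
    the only action with the prescribed generators because every element is the
    class of a word. *)

Set Implicit Arguments.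
Unset Strict Implicit.
Unset Printing Implicit Defensive.

Section Triangles.
Variable n : nat.
Implicit Types (A B : {set 'I_n}) (T U V : MT n) (i j k : 'I_n.-1) (p m : nat).

Lemma elt_ext A B : #|A| = #|B| ->
  (forall p, p < #|A| -> elt A p.+1 = elt B p.+1) -> A = B.
Proof.
move=> cAB eAB; have eE : elts A = elts B.
  apply: (@eq_from_nth _ 0) => [|p]; rewrite !size_elts // => /eAB.
  exact: id.
by apply/setP => x; rewrite -!mem_elts eE.
Qed.

Lemma card_row T m : m <= n -> #|row T m| = m.
Proof.
case: T => t /= tP; have /andP[/forallP tc _] := tP.
by move=> hm; apply/eqP/(tc (Ordinal (hm : m < n.+1))).
Qed.

Lemma row_interlaces T m : m < n -> interlaces (row T m.+1) (row T m).
Proof.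
case: T => t /= tP; have /andP[_ /forallP ti] := tP.
by move=> hm; apply: (ti (Ordinal hm)).
Qed.

(** The convention [a_0 = 0] makes the inequalities hold for [p = 0] as well. *)
Lemma row_le T m p : m < n -> p <= m ->
  elt (row T m.+1) p <= elt (row T m) p <= elt (row T m.+1) p.+1.
Proof.
case: p => // p hm hp; have /andP[_ /forallP h] := row_interlaces T hm.
by rewrite -(card_row T (ltnW hm)) in hp; apply: (h (Ordinal hp)).
Qed.

Lemma row_elt_lt T m p : m <= n -> p < m ->
  elt (row T m) p < elt (row T m) p.+1.
Proof. by move=> hm hp; apply: elt_lt; rewrite card_row. Qed.

Lemma MT_row_ext T T' : (forall m, m <= n -> row T m = row T' m) -> T = T'.
Proof.
move=> h; apply/val_inj/eq_from_tnth => m.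
by rewrite !(tnth_nth set0); apply: h; rewrite -ltnS.
Qed.

Lemma row_mt_piE T k m : m <= n ->
  row (mt_pi T k) m =
  if m == k.+1 then Hmin (row T k) (row T k.+2) else row T m.
Proof. exact: row_mt_pi. Qed.

Lemma row_mt_pi_neq T k m : m <= n -> m != k.+1 ->
  row (mt_pi T k) m = row T m.
Proof. by move=> hm /negPf km; rewrite row_mt_piE // km. Qed.

Lemma elt_mt_pi T k p : p <= k ->
  elt (row (mt_pi T k) k.+1) p.+1 =
  maxn (elt (row T k) p) (elt (row T k.+2) p.+1).
Proof.
move=> hp; have kn := ltn_ord k.
have k0 : k < n by lia.
have k1 : k.+1 < n by lia.
have eH := elts_Hmin (row_interlaces T k0) (row_interlaces T k1).
rewrite row_mt_piE ?eqxx 1?ltnW // {1}/elt /= eH nth_mkseq //.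
by rewrite card_row // ltnW.
Qed.

Lemma mt_pi_comm T i j : 2 <= `|i - j| ->
  mt_pi (mt_pi T i) j = mt_pi (mt_pi T j) i.
Proof.
move=> hij; have [ni nj] := (ltn_ord i, ltn_ord j).
apply: MT_row_ext => m hm; rewrite !row_mt_piE //; try lia.
by do !case: eqP => //; lia.
Qed.

Lemma mt_pi_idem T i : mt_pi (mt_pi T i) i = mt_pi T i.
Proof.
have ni := ltn_ord i.
apply: MT_row_ext => m hm; rewrite !row_mt_piE //; try lia.
by do !case: eqP => //; lia.
Qed.

(** Both sides of the braid relation are pinned down by the same
    equations, in which the rows that change depend only on the rows
    surrounding them, and not on their own former values. Subtraction being
    truncated, [p.-1] at [p = 0] stands for the index [-1], where [elt _ 0 = 0]
    is again the right value. *)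
Definition braid_form T U k :=
  [/\ forall m, m <= n -> m != k.+1 -> m != k.+2 -> row U m = row T m,
      forall p, p <= k ->
        elt (row U k.+1) p.+1 =
        maxn (elt (row T k) p) (elt (row T k.+3) p.+1)
    & forall p, p <= k.+1 ->
        elt (row U k.+2) p.+1 =
        maxn (elt (row T k) p.-1) (elt (row T k.+3) p.+1)].

Lemma braid_form_uniq T U V k : k.+2 < n ->
  braid_form T U k -> braid_form T V k -> U = V.
Proof.
move=> kn [Uo U1 U2] [Vo V1 V2]; apply: MT_row_ext => m hm.
case: (eqVneq m k.+1) => [->|m1].
  apply: elt_ext; rewrite !card_row //; try lia.
  by move=> p hp; rewrite U1 ?V1.
case: (eqVneq m k.+2) => [->|m2]; last by rewrite Uo ?Vo.
apply: elt_ext; rewrite !card_row //; try lia.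
by move=> p hp; rewrite U2 ?V2.
Qed.

(** Row [i.+2] has its final value after two steps; the last step recomputes
    row [i.+1], where [a_(p-2)] is absorbed by [a_(p-1)]. *)
Lemma braid_iji T i j : j = i.+1 :> nat ->
  braid_form T (mt_pi (mt_pi (mt_pi T i) j) i) i.
Proof.
move=> ij; have jn := ltn_ord j.
have E2 p : p <= i.+1 -> elt (row (mt_pi (mt_pi T i) j) i.+2) p.+1 =
    maxn (elt (row T i) p.-1) (elt (row T i.+3) p.+1).
  move=> hp; have := @elt_mt_pi (mt_pi T i) j p; rewrite ij => -> //.
  rewrite (@row_mt_pi_neq _ _ i.+3); try lia.
  case: p hp => [|p] hp //; rewrite elt_mt_pi //=.
  (* [y_(p-1) <= b_p]: the former row [i.+2] is absorbed. *)
  have := @row_le T i.+2 p.+1; lia.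
split=> [m hm m1 m2|p hp|p hp].
- by rewrite !row_mt_pi_neq ?ij.
- rewrite elt_mt_pi // E2; last lia.
  rewrite !row_mt_pi_neq ?ij; try lia.
  case: p hp => [|p] hp /=; first lia.
  have := @row_elt_lt T i p; lia.
- by rewrite row_mt_pi_neq ?E2; lia.
Qed.

(** Row [i.+1] has its final value after two steps; the last step recomputes
    row [i.+2], where [b_(p-1)] is absorbed by [b_p]. *)
Lemma braid_jij T i j : j = i.+1 :> nat ->
  braid_form T (mt_pi (mt_pi (mt_pi T j) i) j) i.
Proof.
move=> ij; have jn := ltn_ord j.
have E1 p : p <= i -> elt (row (mt_pi (mt_pi T j) i) i.+1) p.+1 =
    maxn (elt (row T i) p) (elt (row T i.+3) p.+1).
  move=> hp; rewrite elt_mt_pi //.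
  have := @elt_mt_pi T j p; rewrite ij => -> //; last lia.
  rewrite row_mt_pi_neq ?ij; try lia.
  (* [x_p <= a_p]: the former row [i.+1] is absorbed. *)
  have := @row_le T i p; lia.
split=> [m hm m1 m2|p hp|p hp].
- by rewrite !row_mt_pi_neq ?ij.
- by rewrite row_mt_pi_neq ?E1 ?ij; lia.
- have := @elt_mt_pi (mt_pi (mt_pi T j) i) j p; rewrite ij => -> //.
  rewrite !(@row_mt_pi_neq _ _ i.+3) ?ij; try lia.
  case: p hp => [|p] hp //; rewrite E1 //=.
  have := @row_elt_lt T i.+3 p.+1; lia.
Qed.

Lemma mt_pi_braid T i j : j = i.+1 :> nat ->
  mt_pi (mt_pi (mt_pi T i) j) i = mt_pi (mt_pi (mt_pi T j) i) j.
Proof.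
move=> ij; have jn := ltn_ord j.
by apply: (braid_form_uniq _ (braid_iji T ij) (braid_jij T ij)); lia.
Qed.

Lemma hecke_congr_foldl (u v : seq 'I_n.-1) : hecke_congr u v ->
  forall T, foldl (@mt_pi n) T u = foldl (@mt_pi n) T v.
Proof.
elim=> {u v} [i j|i j|i|u|u v _ IH|u v w _ IHu _ IHv|u u' v v' _ IHu _ IHv] //=.
- by move=> h T; apply: mt_pi_comm.
- by move=> h T; apply: mt_pi_braid.
- by move=> T; apply: mt_pi_idem.
- by move=> T; rewrite IHu.
- by move=> T; rewrite !foldl_cat IHu IHv.
Qed.

Definition hecke_act T (x : hecke n) : MT n := foldl (@mt_pi n) T (repr x).

Lemma hecke_act_word T u : hecke_act T (hecke_word u) = foldl (@mt_pi n) T u.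
Proof.
by apply: hecke_congr_foldl; apply/hecke_wordP; rewrite hecke_wordK.
Qed.

Lemma hecke_act_is_right_action :
  is_right_action (M := hecke n) hecke_act.
Proof.
split=> [T|T x y]; first exact: (hecke_act_word T [::]).
by rewrite [LHS]hecke_act_word foldl_cat.
Qed.

Lemma right_action_word (act : MT n -> hecke n -> MT n) :
  is_right_action (M := hecke n) act ->
  (forall T k, act T (hecke_gen k) = mt_pi T k) ->
  forall u T, act T (hecke_word u) = foldl (@mt_pi n) T u.
Proof.
move=> [act1 actM] actg; elim=> [|k u IH] T; first exact: act1.
by rewrite -[k :: u]cat1s -hecke_mul_word [LHS]actM actg IH.
Qed.

End Triangles.

Theorem proposition3p2 (n : nat) (hn : 1 <= n) :
  (forall (T : MT n) (i j : 'I_n.-1), 2 <= `|i - j| ->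
     mt_pi (mt_pi T i) j = mt_pi (mt_pi T j) i) /\
  (forall (T : MT n) (i j : 'I_n.-1), j = i.+1 :> nat ->
     mt_pi (mt_pi (mt_pi T i) j) i = mt_pi (mt_pi (mt_pi T j) i) j) /\
  (forall (T : MT n) (i : 'I_n.-1), mt_pi (mt_pi T i) i = mt_pi T i) /\
  (exists! act : MT n -> hecke n -> MT n,
     is_right_action (M := hecke n) act /\
     (forall (T : MT n) (i : 'I_n.-1), act T (hecke_gen i) = mt_pi T i)).
Proof.
split; first exact: mt_pi_comm.
split; first exact: mt_pi_braid.
split; first exact: mt_pi_idem.
exists (@hecke_act n); split.
  split=> [|T i]; first exact: hecke_act_is_right_action.
  exact: (hecke_act_word T [:: i]).
move=> act [actP actg]; apply/funext => T; apply/funext => x.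
by rewrite -(hecke_wordK x) hecke_act_word (right_action_word actP actg).
Qed.
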